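(* Let $G$ be a simple connected graph with $p$ vertices and $q$ edges such that its subdivision graph $S(G)$ is integral, and let $k$ be a positive integer that is a perfect square. Then $S(G)_k$ is integral.
   Context: A graph is integral if all eigenvalues of its adjacency matrix are integers. The subdivision graph $S(G)$ is obtained by inserting a new vertex into every edge of $G$. The graph $S(G)_k$ ($k$ a positive integer) is obtained as follows: for every edge $e_i$ of $G$ introduce a set of $k$ new isolated vertices, make each of them adjacent to the two endpoints of $e_i$, and then remove all the original edges of $G$. *)

(* Defs.v *)
From mathcomp Require Import all_boot all_order all_algebra all_field.

Set Implicit Arguments.
Unset Strict Implicit.
Unset Printing Implicit Defensive.

Import Order.TTheory GRing.Theory Num.Theory.

Record sgraph := SGraph {
  vertex :> finType;
  adj : rel vertex;
  adj_sym : symmetric adj;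
  adj_irrefl : irreflexive adj }.

Definition connected_graph (G : sgraph) : Prop :=
  0 < #|G| /\ forall x y : G, connect (@adj G) x y.

Definition edges (G : sgraph) : {set {set G}} :=
  [set e : {set G} | [exists x : G, exists y : G, adj x y && (e == [set x; y])]].

Definition edge (G : sgraph) : finType := {e : {set G} | e \in edges G}.

Definition adj_mx (R : nzRingType) (G : sgraph) : 'M[R]_#|G| :=
  (\matrix_(i, j) (adj (enum_val i) (enum_val j))%:R)%R.

(* No eigenvalue is missed by working over [algC]: it is algebraically closed
   of characteristic 0 and the matrix has integer entries. *)
Definition integral_graph (G : sgraph) : Prop :=
  forall a : algC, eigenvalue (adj_mx algC G) a -> a \in Num.int.

Section Subdivision.
Variable G : sgraph.

Definition subdivision_adj : rel (G + edge G) := fun u v =>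
  match u, v with
  | inl x, inr e => x \in val e
  | inr e, inl x => x \in val e
  | _, _ => false
  end.

Lemma subdivision_adj_sym : symmetric subdivision_adj.
Proof. by case=> [x|e] [y|f]. Qed.

Lemma subdivision_adj_irrefl : irreflexive subdivision_adj.
Proof. by case. Qed.

Definition subdivision : sgraph :=
  SGraph subdivision_adj_sym subdivision_adj_irrefl.

Variable k : nat.

(* [inr (e, i)] is the i-th of the k new vertices attached to the edge e. *)
Definition ksubdivision_adj : rel (G + edge G * 'I_k) := fun u v =>
  match u, v with
  | inl x, inr (e, _) => x \in val e
  | inr (e, _), inl x => x \in val e
  | _, _ => false
  end.

Lemma ksubdivision_adj_sym : symmetric ksubdivision_adj.
Proof. by case=> [x|[e i]] [y|[f j]]. Qed.

Lemma ksubdivision_adj_irrefl : irreflexive ksubdivision_adj.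
Proof. by case=> [x|[e i]]. Qed.

Definition ksubdivision : sgraph :=
  SGraph ksubdivision_adj_sym ksubdivision_adj_irrefl.

End Subdivision.

(* Main.v *)
Require Import Defs.
From mathcomp Require Import all_boot all_order all_algebra all_field.

(** Read an eigenvector of an adjacency matrix as a function on vertices whose
    sum over the neighbours of each vertex is [a] times its value there
    ([eigenvalue_adj_mxP]).

    Let [f] be such a function on S(G)_k with [a != 0].  The [k] vertices
    attached to an edge [e] have the same two neighbours, the endpoints of [e],
    so [f] takes the same value [h e] on all of them
    ([ksubdivision_eigenfunction_new]).  Hence, at a vertex [x] of [G],
    [a * f x] is [k] times the sum of the [h e] over the edges [e] at [x], and
    at an edge [a * h e] is the sum of [f] over the endpoints.  When
    [k = m ^ 2], replacing [h] by [m * h] balances the two relations: they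
    become the eigenvalue equations of S(G) for [a / m]
    ([eigenvalue_ksubdivision_scaled]).

    So every nonzero eigenvalue of S(G)_k is [m] times one of S(G), which is an
    integer. *)

Import GRing.Theory Num.Theory.

Definition eigenfunction {R : nzRingType} (G : sgraph) (a : R) (f : G -> R) :
    Prop :=
  forall x, (\sum_(y | adj x y) f y = a * f x)%R.

Lemma eigenvalue_adj_mxP {F : fieldType} {G : sgraph} (a : F) :
  eigenvalue (adj_mx F G) a <->
  exists2 f : G -> F, eigenfunction G a f & exists x, (f x != 0)%R.
Proof.
split=> [/eigenvalueP[v va v0]|[f fa [x fx0]]].
  exists (fun x => v ord0 (enum_rank x)).
    move=> x; move/matrixP/(_ ord0 (enum_rank x)): va.
    rewrite !mxE => <-.
    rewrite [RHS](reindex enum_rank) /=; last first.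
      by apply: onW_bij; exact: enum_rank_bij.
    rewrite [LHS]big_mkcond; apply: eq_bigr => y _ /=.
    rewrite mxE !enum_rankK adj_sym.
    by case: ifP; rewrite ?mulr1 ?mulr0.
  have /rV0Pn[i vi] : v != 0%R by [].
  by exists (enum_val i); rewrite enum_valK.
apply/eigenvalueP; exists (\row_i f (enum_val i))%R; last first.
  by apply/rV0Pn; exists (enum_rank x); rewrite mxE enum_rankK.
apply/rowP => j; rewrite !mxE -fa.
rewrite [LHS](reindex enum_rank) /=; last first.
  by apply: onW_bij; exact: enum_rank_bij.
rewrite [RHS]big_mkcond; apply: eq_bigr => y _ /=.
rewrite !mxE !enum_rankK adj_sym.
by case: ifP; rewrite ?mulr1 ?mulr0.
Qed.

Lemma subdivision_eigenfunctionP {R : nzRingType} {G : sgraph} (a : R)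
    (f : subdivision G -> R) :
  eigenfunction (subdivision G) a f <->
  (forall x, \sum_(e : edge G | x \in val e) f (inr e) = a * f (inl x))%R /\
  (forall e : edge G, \sum_(x in val e) f (inl x) = a * f (inr e))%R.
Proof.
have sum_old (x : G) : (\sum_(v | @adj (subdivision G) (inl x) v) f v =
    \sum_(e : edge G | x \in val e) f (inr e))%R.
  by rewrite big_sumType /= big_pred0_eq add0r.
have sum_new (e : edge G) : (\sum_(v | @adj (subdivision G) (inr e) v) f v =
    \sum_(x in val e) f (inl x))%R.
  by rewrite big_sumType /= big_pred0_eq addr0.
split=> [fa|[fx fe] [x|e]].
- by split=> u; rewrite -fa ?sum_old ?sum_new.
- by rewrite sum_old.
- by rewrite sum_new.
Qed.

Lemma ksubdivision_eigenfunction_old {R : nzRingType} {G : sgraph} {k : nat}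
    {a : R} {f : ksubdivision G k -> R} (x : G) :
  eigenfunction (ksubdivision G k) a f ->
  (\sum_(e : edge G | x \in val e) \sum_(i < k) f (inr (e, i)) =
   a * f (inl x))%R.
Proof.
move=> /(_ (inl x)) <-; rewrite big_sumType /= big_pred0_eq add0r.
rewrite pair_big_dep /=.
by apply: eq_big => [] [e i] //=; rewrite andbT.
Qed.

(** The left-hand side does not mention [i], since the vertices attached to one
    edge are twins; when [a] is invertible this forces [f] to be constant on
    them. *)
Lemma ksubdivision_eigenfunction_new {R : nzRingType} {G : sgraph} {k : nat}
    {a : R} {f : ksubdivision G k -> R} (e : edge G) (i : 'I_k) :
  eigenfunction (ksubdivision G k) a f ->
  (\sum_(x in val e) f (inl x) = a * f (inr (e, i)))%R.
Proof.
move=> /(_ (inr (e, i))) <-; rewrite big_sumType /=.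
by rewrite [X in (_ + X)%R]big_pred0 ?addr0 // => -[].
Qed.

(** In terms of the rescaled edge values [b * h e], the neighbour sums carry a
    factor [k / b] at the vertices of [G] and [b] at the edges.  The two agree
    when [b] is a square root of [k], and the common factor then moves to the
    eigenvalue. *)
Lemma eigenvalue_ksubdivision_scaled {F : fieldType} {G : sgraph} {k : nat}
    {a b : F} :
  (b != 0)%R -> (b ^+ 2 = k%:R)%R -> (a != 0)%R ->
  eigenvalue (adj_mx F (ksubdivision G k)) a ->
  eigenvalue (adj_mx F (subdivision G)) (a / b)%R.
Proof.
move=> b0 bk a0 /eigenvalue_adj_mxP[f fa [u fu0]].
pose h (e : edge G) := (a^-1 * \sum_(x in val e) f (inl x))%R.
have fh e i : f (inr (e, i)) = h e.
  by rewrite /h (ksubdivision_eigenfunction_new e i fa) mulKf.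
apply/eigenvalue_adj_mxP.
exists (fun v => match v with inl x => f (inl x) | inr e => b * h e end)%R.
  apply/subdivision_eigenfunctionP; split=> [x|e].
    rewrite mulrAC -(ksubdivision_eigenfunction_old x fa).
    rewrite mulr_suml; apply: eq_bigr => e _.
    under eq_bigr => i _ do rewrite fh.
    rewrite sumr_const card_ord -mulr_natl -bk expr2.
    by rewrite -(mulrA b b) (mulrC b (b * h e)%R) mulfK.
  by rewrite mulrA divfK // /h mulVKf.
case: u fu0 => [x|[e i]] fu0; first by exists (inl x).
by exists (inr e); rewrite mulf_neq0 // -(fh e i).
Qed.

Theorem corollary3p4 (G : sgraph) (p q k : nat)
    (Gconn : connected_graph G)
    (Gp : #|G| = p) (Gq : #|edges G| = q)
    (SGint : integral_graph (subdivision G))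
    (k_gt0 : 0 < k) (k_square : exists m : nat, k = m ^ 2) :
  integral_graph (ksubdivision G k).
Proof.
have [m km] := k_square.
move=> a a_eig; have [->|a0] := eqVneq a 0%R; first exact: rpred0.
have m0 : (m%:R != 0 :> algC)%R.
  by rewrite pnatr_eq0; apply: contraL k_gt0 => /eqP m0; rewrite km m0.
have m2 : (m%:R ^+ 2 = k%:R :> algC)%R by rewrite km natrX.
rewrite -[a](divfK m0) rpredM ?rpred_nat //.
exact: SGint (eigenvalue_ksubdivision_scaled m0 m2 a0 a_eig).
Qed.
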